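(* Let $G$ be a Polish group, $X$ a separable metrizable space and $f:G\to X$ a function with the Baire property. If $f$ is $(S,T)$ shift continuous for a set $S\subset G$ with the Baire property and a set $T\subset G$, then $f$ is continuous at every point of $\mathrm{BD}(S)+\mathrm{SC}(T)$.
   Context: The group $G$ is not assumed Abelian, but its operation is written additively; $A+B=\{a+b : a\in A,\ b\in B\}$. For $S,T\subset G$, a function $f:G\to X$ is called $(S,T)$ shift continuous if there exists a second countable topology $\mathcal{T}$ on the set $T$ such that for every $s_0\in S$ the function $T\to X$, $t\mapsto f(s_0+t)$, is $\mathcal{T}$-continuous. A set is of first category if it is a countable union of nowhere dense sets, and of second category otherwise. A function has the Baire property if preimages of open sets have the Baire property. $\mathrm{BD}(S)$ is the set of Baire density points of $S$: all $x\in G$ (possibly outside $S$) for which there is an open $U\ni x$ with $U\setminus S$ of first category. $\mathrm{SC}(T)$ is the set of second category points of $T$: all $x\in G$ (possibly outside $T$) such that for every open $U\ni x$ the set $T\cap U$ is of second category. *)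

(* Defs.v *)
From HB Require Import structures.
From mathcomp Require Import all_boot all_algebra.
From mathcomp Require Import all_classical all_reals all_analysis.

Set Implicit Arguments.
Unset Strict Implicit.
Unset Printing Implicit Defensive.

Local Open Scope classical_set_scope.

(* Groups are not assumed commutative, so they are [groupType]s and the group
   law, although customarily written additively here, is [_ * _] in %g. *)
HB.mixin Record isTopologicalGroup G & Group G & Topological G := {
  mulg_continuous : continuous (fun xy : G * G => (xy.1 * xy.2)%g) ;
  invg_continuous : continuous (fun x : G => (x^-1)%g)
}.

#[short(type="topologicalGroupType")]
HB.structure Definition TopologicalGroup :=
  {G of Group G & Topological G & isTopologicalGroup G}.

Section Metrizability.
Context (R : realType).

Definition separable (T : topologicalType) :=
  exists2 D : set T, countable D & dense D.

(* [Metric R T] is the type of metric structures on the bare carrier of [T];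
   such a structure carries its own topology, compared here with that of [T]. *)
Definition metrized_by (T : topologicalType) (m : Metric R T) :=
  @open (Metric.Pack m) = @open T.

Definition metrizable (T : topologicalType) :=
  exists m : Metric R T, metrized_by m.

(* The library's [completeType] moreover requires a distinguished point. *)
Definition complete_uniform (M : uniformType) :=
  forall F : set_system M, ProperFilter F -> cauchy F -> exists l : M, F --> l.

Definition polish (T : topologicalType) :=
  separable T /\
  exists2 m : Metric R T, metrized_by m & complete_uniform (Metric.Pack m).

End Metrizability.

Section Category.
Context {T : topologicalType}.
Implicit Types A S : set T.

Definition nowhere_dense A := (closure A)° = set0.

Definition first_category A :=
  exists2 F : (set T)^nat,
    (forall n, nowhere_dense (F n)) & A = \bigcup_n F n.

Definition second_category A := ~ first_category A.

Definition baire_property A :=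
  exists2 U : set T, open U & first_category (A `+` U).

Definition baire_function (X : topologicalType) (f : T -> X) :=
  forall V : set X, open V -> baire_property (f @^-1` V).

Definition BD S : set T :=
  [set x | exists2 U : set T, open_nbhs x U & first_category (U `\` S)].

Definition SC A : set T :=
  [set x | forall U : set T, open_nbhs x U -> second_category (A `&` U)].

End Category.

(* [tau] ranges over all topologies on the subset [T] seen as a type; it is
   unrelated to the subspace topology inherited from [G]. *)
Definition shift_continuous (G : groupType) (X : topologicalType)
    (S T : set G) (f : G -> X) :=
  exists2 tau : Topological T, @second_countable (Topological.Pack tau) &
    forall s0, S s0 ->
      continuous (fun t : Topological.Pack tau => f (s0 * \val (t : T))%g).

(* Main.v *)
(* After removing a first category
   set from [T], every [t \in T] is a second category point of each of its basic
   neighbourhoods in the second countable topology on [T]. If [x] is in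
   [BD S * SC T], then for every [y] near [x] second category many [t \in T]
   satisfy [y / t \in S]; hence [y] is a second category point of the preimage
   of every neighbourhood of [f y]. For [f x \in V], each such [t] has a basic
   neighbourhood [B] with [f (x / t * B) `<=` V], so one and the same [B] works
   for a second category set of [t]. This prevents points near [x] from being
   second category points of the preimage of an open set disjoint from [V], so
   their images avoid that open set, and regularity of [X] gives continuity. *)
Require Import Defs.
From HB Require Import structures.
From mathcomp Require Import all_boot all_order all_algebra.
From mathcomp Require Import all_classical all_reals all_analysis.

Set Implicit Arguments.
Unset Strict Implicit.
Unset Printing Implicit Defensive.

Import Order.TTheory GRing.Theory Num.Theory.

Local Open Scope classical_set_scope.

(** * Baire category and second category points in a topological space *)

Section Category.
Context {T : topologicalType}.
Implicit Types A B E U V : set T.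

Lemma nowhere_dense_subset A B :
  A `<=` B -> nowhere_dense B -> nowhere_dense A.
Proof.
move=> AB; rewrite /nowhere_dense -!subset0; apply: subset_trans.
exact/interiorS/closureS.
Qed.

Lemma first_category_subset A B :
  A `<=` B -> first_category B -> first_category A.
Proof.
move=> AB [F Fnd BF]; exists (fun n => A `&` F n).
  by move=> n; apply: nowhere_dense_subset (Fnd n); exact: subIsetr.
by rewrite -setI_bigcupr -BF (setIidl AB).
Qed.

Lemma first_category0 : first_category (@set0 T).
Proof.
exists (fun=> set0); last by rewrite bigcup0.
by move=> n; rewrite /nowhere_dense closure0 interior0.
Qed.

Lemma nowhere_dense_first_category A : nowhere_dense A -> first_category A.
Proof.
by move=> ndA; exists (fun=> A) => //; rewrite bigcup_const//; exists 0%N.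
Qed.

Lemma first_category_bigcup_nat (F : (set T)^nat) :
  (forall n, first_category (F n)) -> first_category (\bigcup_n F n).
Proof.
move=> fcF; have /choice[H HP] n : exists H : (set T)^nat,
    (forall k, nowhere_dense (H k)) /\ F n = \bigcup_k H k.
  by have [H] := fcF n; exists H.
(* The double union is reindexed through a coding of pairs; codes of no pair get the empty set. *)
pose K i :=
  if @unpickle (nat * nat)%type i is Some nk then H nk.1 nk.2 else set0.
exists K => [i|].
  rewrite /K; case: unpickle => [nk|]; first exact: (HP nk.1).1.
  by rewrite /nowhere_dense closure0 interior0.
apply/seteqP; split=> x [n _].
  rewrite (HP n).2 => -[k _ Hx].
  by exists (pickle (n, k)) => //; rewrite /K pickleK.
rewrite /K; case: unpickle => [[m k]/= Hx|//].
by exists m => //; rewrite (HP m).2; exists k.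
Qed.

Lemma first_category_bigcup (I : Type) (D : set I) (F : I -> set T) :
  countable D -> (forall i, D i -> first_category (F i)) ->
  first_category (\bigcup_(i in D) F i).
Proof.
move=> /countable_injP[g ginj] fcF.
(* Indices are grouped by the value of [g]; injectivity on [D] leaves at most one in each group. *)
apply: (@first_category_subset _
  (\bigcup_n \bigcup_(i in [set i | D i /\ g i = n]) F i)).
  by move=> x [i Di Fix]; exists (g i) => //; exists i.
apply: first_category_bigcup_nat => n.
have [[i [Di gi]]|Nn] := pselect (exists i, D i /\ g i = n); last first.
  apply: first_category_subset first_category0 => x [i Din _].
  by apply: Nn; exists i.
apply: first_category_subset (fcF _ Di) => x [j [Dj gj]].
by rewrite (ginj j i) ?inE ?gj ?gi.
Qed.

Lemma first_categoryU A B :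
  first_category A -> first_category B -> first_category (A `|` B).
Proof.
move=> fcA fcB; rewrite -bigcup2E; apply: first_category_bigcup_nat.
by move=> [|[|n]] //=; exact: first_category0.
Qed.

Lemma second_category_nonempty A : second_category A -> A !=set0.
Proof.
by move=> scA; apply/set0P/eqP => A0; apply: scA; rewrite A0;
  exact: first_category0.
Qed.

Lemma closed_SC A : closed (SC A).
Proof.
rewrite -openC openE => x /existsNP[U /not_implyP[oxU /contrapT fcU]].
have [oU _] := oxU.
apply: (filterS _ (open_nbhs_nbhs oxU)) => y Uy /(_ U).
by apply.
Qed.

Context (Tsc : @second_countable T).

(** Each point of [A] outside [SC A] has a basic neighbourhood meeting [A] in a first category set,
    and there are only countably many basic sets. *)
Lemma first_category_setD_SC A : first_category (A `\` SC A).
Proof.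
have [B cB [oB bB]] := Tsc.
apply: (@first_category_subset _ (\bigcup_(V in
    [set V | B V /\ first_category (A `&` V)]) (A `&` V))); last first.
  by apply: first_category_bigcup => [|V []//]; apply: sub_countable cB;
    apply: subset_card_le => V [].
move=> x [Ax /existsNP[U /not_implyP[oxU /contrapT fcU]]].
have [V [BV Vx] VU] := bB x _ (open_nbhs_nbhs oxU).
exists V => //; split=> //.
by apply: first_category_subset fcU; exact: setIS.
Qed.

(** Being closed, [SC A] would be nowhere dense if its interior were empty; yet it covers [A] up to
    a first category set. *)
Lemma second_category_interior_SC A :
  second_category A -> (SC A)° !=set0.
Proof.
move=> scA; apply/set0P/eqP => SC0; apply: scA.
apply: (@first_category_subset _ ((A `\` SC A) `|` SC A)).
  by move=> x Ax; have [|] := pselect (SC A x); [right|left].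
apply: first_categoryU; first exact: first_category_setD_SC.
apply: nowhere_dense_first_category.
by rewrite /nowhere_dense -(closure_id _).1//; exact: closed_SC.
Qed.

End Category.

(** If the open set equal to [E] modulo first category missed [N], then [E] would be of first
    category in [N]. *)
Lemma baire_property_SC {T : topologicalType} (E : set T) (y : T) (N : set T) :
  baire_property E -> SC E y -> open_nbhs y N ->
  exists2 U : set T, open U /\ U !=set0 & U `<=` N /\ first_category (U `\` E).
Proof.
move=> [U oU fcEU] Ey yN; have [oN _] := yN; exists (U `&` N).
  split; first exact: openI.
  apply/set0P/eqP => UN0; apply: (Ey N yN).
  apply: first_category_subset fcEU => z [Ez Nz]; left; split => // Uz.
  by have : (U `&` N) z by []; rewrite UN0.
split; first exact: subIsetr.
by apply: first_category_subset fcEU => z [[Uz _] nEz]; right.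
Qed.

Lemma first_category_preimage {T T' : topologicalType} (h : T -> T')
    (k : T' -> T) (A : set T') :
  continuous h -> continuous k -> cancel h k -> cancel k h ->
  first_category A -> first_category (h @^-1` A).
Proof.
move=> /continuousP ch /continuousP ck hK kh [F Fnd ->].
rewrite preimage_bigcup; exists (fun n => h @^-1` F n) => // n.
rewrite /nowhere_dense -subset0 => x.
rewrite /interior nbhsE => -[U [oU Ux] UF].
have : (closure (F n))° (h x).
  rewrite /interior nbhsE; exists (k @^-1` U).
    by split; [exact: ck|rewrite /= hK].
  move=> y /UF Fy W; rewrite nbhsE => -[W0 [oW0 W0y] W0W].
  have [|z [Fz W0z]] := Fy (h @^-1` W0).
    by rewrite nbhsE; exists (h @^-1` W0) => //; split;
      [exact: ch|rewrite /= kh].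
  by exists (h z); split => //; exact: W0W.
by rewrite Fnd.
Qed.

(** * Translations and shift continuity in a topological group *)

Section Group.
Context {G : topologicalGroupType}.
Implicit Types (a b x y z : G) (A B E P : set G).
Local Open Scope group_scope.

Lemma continuous_mulg {T : topologicalType} (g h : T -> G) :
  continuous g -> continuous h -> continuous (fun t => g t * h t).
Proof.
move=> cg ch t; apply: (@cvg_comp _ _ _ (fun t => (g t, h t))
  (fun xy : G * G => xy.1 * xy.2) _ (nbhs (g t, h t))).
  exact: cvg_pair (cg t) (ch t).
exact: mulg_continuous (g t, h t).
Qed.

Lemma continuous_invg {T : topologicalType} (g : T -> G) :
  continuous g -> continuous (fun t => (g t)^-1).
Proof. by move=> cg t; apply: continuous_comp (cg t) (invg_continuous _). Qed.

Lemma SC_mulg a b B E : SC B b -> (forall t, B t -> E (a * t)) -> SC E (a * b).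
Proof.
move=> Bb BE U [oU Uab] fcEU.
have ca c : continuous (fun t : G => c * t).
  by apply: continuous_mulg => // t; [exact: cvg_cst|exact: cvg_id].
apply: (Bb ((fun t => a * t) @^-1` U)).
  by split=> //; move: U oU {Uab fcEU}; apply/continuousP.
apply: (first_category_subset _ (first_category_preimage (ca a) (ca a^-1)
  (mulKg a) (mulVKg a) fcEU)).
by move=> t [/BE].
Qed.

Section Shift.
Context {X : topologicalType} (f : G -> X) (fB : baire_function f).

(* If [U] is a small open set in which the preimage of [V'] is residual, then
   the points [x * p^-1 * b] with [p \in P], which lie in the preimage of [V],
   fill a second category part of [U]. *)
Lemma not_SC_preimage (V V' : set X) P B x o b :
  open V' -> V `&` V' = set0 ->
  (forall p b, P p -> B b -> V (f (x * p^-1 * b))) ->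
  (SC P)° o -> B b -> ~ SC (f @^-1` V') (x * o^-1 * b).
Proof.
move=> oV' VV' PBV Oo Bb SCy.
have cid : continuous (@id G) by move=> t; exact: cvg_id.
have cc (c : G) : continuous (fun _ : G => c) by move=> t; exact: cvg_cst.
pose h p := x * p^-1 * b; pose k z := b * z^-1 * x.
have ch : continuous h.
  by do !(apply: continuous_mulg => //); exact: continuous_invg.
have ck : continuous k.
  by do !(apply: continuous_mulg => //); exact: continuous_invg.
have hK : cancel h k.
  by move=> p; rewrite /h /k !invgM invgK !mulgA mulgV mul1g mulgVK.
have kK : cancel k h.
  by move=> p; rewrite /h /k !invgM invgK !mulgA mulgV mul1g mulgVK.
have oSC := open_interior (SC P).
have [U [oU [q Uq]] [UN fcU]] : exists2 U : set G, open U /\ U !=set0 &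
    U `<=` k @^-1` (SC P)° /\ first_category (U `\` f @^-1` V').
  apply: baire_property_SC SCy _; first exact: fB.
  by split; [move/continuousP: ck; exact|rewrite /= -/(h o) hK].
have /interior_subset SCPq := UN q Uq.
apply: (SCPq (h @^-1` U)).
  by split; [move/continuousP: ch; exact|rewrite /= kK].
apply: (first_category_subset _ (first_category_preimage ch ck hK kK fcU)).
move=> p [Pp Up]; split => //= V'p.
have : (V `&` V') (f (h p)) by split => //; exact: PBV.
by rewrite VV'.
Qed.

End Shift.

(** Division sends [(a * b, b)] to [a], so by joint continuity one neighbourhood of [b] works for
    all [y] near [a * b]: its points [t] satisfy [y * t^-1 \in U]. Those with [y * t^-1] outside [S]
    form a first category set, by homeomorphic preimage. *)
Lemma BD_SC_near a b S T :
  BD S a -> SC T b ->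
  \forall y \near a * b, second_category (T `&` [set t | S (y * t^-1)]).
Proof.
move=> [U [oU Ua] fcUS] Tb.
have cdiv : continuous (fun yt : G * G => yt.1 * yt.2^-1).
  apply: continuous_mulg => [yt|]; first exact: cvg_fst.
  by apply: continuous_invg => yt; exact: cvg_snd.
have [|[Q N] /= [Qab Nb] QN] := cdiv (a * b, b) U.
  by rewrite /= mulgK; exact: open_nbhs_nbhs.
apply: filterS Qab => y Qy fcT.
move: Nb; rewrite nbhsE => -[N' [oN' N'b] N'N].
apply: (Tb N') => //.
have fcV : first_category [set t | (U `\` S) (y * t^-1)].
  have cid : continuous (@id G) by move=> t; exact: cvg_id.
  have cc (c : G) : continuous (fun _ : G => c) by move=> t; exact: cvg_cst.
  apply: (@first_category_preimage _ _ (fun t => y * t^-1)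
    (fun z => z^-1 * y) (U `\` S)) => //.
  - by apply: continuous_mulg => //; exact: continuous_invg.
  - by apply: continuous_mulg => //; exact: continuous_invg.
  - by move=> t; rewrite invgM invgK mulgVK.
  - by move=> t; rewrite invgM invgK mulVKg.
apply: first_category_subset (first_categoryU fcT fcV) => t [Tt N't].
have [St|nSt] := pselect (S (y * t^-1)); first by left.
by right; split => //; apply: (QN (y, t)); split => //; exact: N'N.
Qed.

Context (Gsc : @second_countable G).

(** The topology on [T] is traded for the countable family [C] of images in [G] of its basic open
    sets. Second category points are taken in the topology of [G], and [T'] drops from each [B] in
    [C] its points outside [SC B]. *)
Lemma shift_continuous_category (X : topologicalType) (f : G -> X)
    (S T : set G) :
  shift_continuous S T f ->
  exists T' : set G, exists2 C : set (set G), countable C &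
    first_category (T `\` T') /\
    forall s t (V : set X), S s -> T' t -> open V -> V (f (s * t)) ->
    exists2 B, C B /\ B t & SC B t /\ forall t', B t' -> V (f (s * t')).
Proof.
move=> [tau [D cD [oD bD]] cf].
pose TT : topologicalType := Topological.Pack tau.
pose C := [set [set \val (t : T) | t in (W : set TT)] | W in D].
exists (T `\` \bigcup_(B in C) (B `\` SC B)), C.
  exact: sub_countable (card_image_le _ _) cD.
split.
  apply: (@first_category_subset _ _ (\bigcup_(B in C) (B `\` SC B))).
    by move=> t [Tt nT]; apply: contrapT => nC; apply: nT.
  apply: first_category_bigcup => [|B _].
    exact: sub_countable (card_image_le _ _) cD.
  exact: first_category_setD_SC.
move=> s t V Ss [Tt nCt] oV Vst.
pose t0 : TT := SigSub (mem_set Tt) : T.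
have /(cf s Ss t0) : nbhs (f (s * \val (t0 : T))) V by exact: open_nbhs_nbhs.
move=> /bD[W [DW Wt0] WV]; pose B := [set \val (t : T) | t in (W : set TT)].
have CB : C B by exists W.
have Bt : B t by exists t0.
exists B => //; split; last by move=> _ [t' Wt' <-]; exact: WV.
by apply: contrapT => nSC; apply: nCt; exists B.
Qed.

Lemma shift_continuous_at (X : topologicalType) (f : G -> X) (S T : set G) x :
  regular_space X -> baire_function f -> shift_continuous S T f ->
  [set a * b | a in BD S & b in SC T] x -> {for x, continuous f}.
Proof.
move=> Xreg fB /shift_continuous_category[T' [C cC [fcT' fC]]].
move=> [a Sa [b Tb <-]].
have T'b : SC T' b.
  move=> U Ub fcU; apply: (Tb U Ub).
  apply: first_category_subset (first_categoryU fcU fcT') => t [Tt Ut].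
  by have [T't|nT't] := pselect (T' t); [left|right].
have nT' := BD_SC_near Sa T'b.
move: (a * b) nT' => {a b Sa Tb T'b} x0 nT'.
(* One such [t] is enough: left translation by [y * t^-1] carries [t] to [y] and [B] into the
   preimage of [V]. *)
have fSC y : second_category (T' `&` [set t | S (y * t^-1)]) ->
    forall V : set X, open V -> V (f y) -> SC (f @^-1` V) y.
  move=> /second_category_nonempty[t [T't St]] V oV Vfy.
  have [|B [_ Bt] [SCB BV]] := fC _ _ V St T't oV; first by rewrite mulgVK.
  by rewrite -(mulgVK t y); apply: SC_mulg SCB _.
move=> W; rewrite nbhsE => -[W0 [oW0 W0x] W0W].
have [||V [V' [oV oV' Vx V'W VV']]] :=
  (regular_openP (f x0)).1 (Xreg (f x0)) (~` W0); first exact: open_closedC.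
  exact.
(* Pigeonhole: a second category set of [t] is covered by countably many sets, one for each [B]. *)
have [B CB scP] : exists2 B, C B & second_category
    [set t | B t /\ forall t', B t' -> V (f (x0 * t^-1 * t'))].
  apply: contrapT => nB; apply: (nbhs_singleton nT').
  apply: (@first_category_subset _ _ (\bigcup_(B in C)
      [set t | B t /\ forall t', B t' -> V (f (x0 * t^-1 * t'))])).
    move=> t [T't St].
    have [|B [CB Bt] [_ BV]] := fC _ _ V St T't oV; first by rewrite mulgVK.
    by exists B.
  apply: first_category_bigcup => // B CB.
  by apply: contrapT => scB; apply: nB; exists B.
set P := [set t | _] in scP.
have [q Oq] := second_category_interior_SC Gsc scP.
(* This [p] later serves as the point of [B] in [not_SC_preimage]. *)
have [p [Pp Op]] : P `&` (SC P)° !=set0.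
  apply: second_category_nonempty; apply: (interior_subset Oq).
  by split => //; exact: open_interior.
(* Solving [y = x0 * o^-1 * p] for [o] gives this map; it takes the value [p] at [x0], so [o] stays
   in the interior of [SC P] for [y] near [x0]. *)
have ck : continuous (fun y => p * y^-1 * x0).
  have cc (c : G) : continuous (fun _ : G => c) by move=> t; exact: cvg_cst.
  do 2!apply: continuous_mulg => //.
  by apply: continuous_invg => t; exact: cvg_id.
have nP : \forall y \near x0, (SC P)° (p * y^-1 * x0).
  apply: (ck x0); apply: open_nbhs_nbhs; split; first exact: open_interior.
  by rewrite mulgVK.
apply: filterS2 nT' nP => y Ty Py.
apply: W0W; apply: contrapT => nW0y.
have /(fSC y Ty V' oV') : V' (f y) by exact: V'W.
have -> : y = x0 * (p * y^-1 * x0)^-1 * p.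
  by rewrite !invgM invgK !mulgA mulgV mul1g mulgVK.
apply: (not_SC_preimage fB oV' VV') Py Pp.1 => p' b' [_]; exact.
Qed.

End Group.

Lemma metrizable_regular (R : realType) (X : topologicalType) :
  metrizable R X -> regular_space X.
Proof.
move=> [m mX] x; apply/regular_openP => A clA nAx.
pose M : topologicalType := Metric.Pack m.
have oE : @open M = @open X := mX.
have clMA : @closed M A by rewrite -openC oE openC.
have [U [V []]] := (@regular_openP M x).1 (@uniform_regular (Metric.Pack m) x)
  A clMA nAx.
by rewrite oE; exists U, V.
Qed.

Lemma separable_second_countable (R : realType) (M : pseudoMetricType R) :
  separable M -> @second_countable M.
Proof.
move=> [D cD dD].
(* Interiors are taken because balls of a pseudometric structure need not be open here. *)
pose b (dn : M * nat) : set M := (ball dn.1 (dn.2.+1%:R^-1))°.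
exists [set b dn | dn in D `*` [set: nat]].
  by apply: sub_countable (card_image_le _ _) _; exact: countableX.
split=> [_ [dn _ <-]|x]; first exact: open_interior.
move=> U /nbhs_ballP[e /= e0 eU].
have [n ne] : exists n, (n.+1%:R^-1 < e / 2 :> R)%R.
  have e20 : (0 < e / 2 :> R)%R by rewrite divr_gt0.
  by have [n ne] := ltr_add_invr e20; exists n; move: ne; rewrite add0r.
have n0 : (0 < n.+1%:R^-1 :> R)%R by rewrite invr_gt0.
have n20 : (0 < n.+1%:R^-1 / 2 :> R)%R by rewrite divr_gt0.
(* Half the radius leaves room for a ball around [x] inside the ball around [d], which puts [x] in
   its interior. *)
have [|d [/interior_subset dx Dd]] :=
  dD (ball x (n.+1%:R^-1 / 2))° _ (open_interior _).
  by exists x; exact: nbhsx_ballx.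
exists (b (d, n)); first split.
- by exists (d, n).
- apply: (filterS _ (nbhsx_ballx x _ n20)) => z xz.
  rewrite [X in ball d X](splitr _).
  by apply: ball_triangle xz; exact: ball_sym.
move=> y /interior_subset /= dy; apply: eU; rewrite (splitr e).
apply: (@ball_triangle _ _ d).
  apply: le_ball dx; apply: le_trans (ltW ne).
  by rewrite ler_pdivrMr// ler_peMr// ?ler1n// ltW.
by apply: le_ball dy; exact: ltW.
Qed.

Lemma polish_second_countable (R : realType) (T : topologicalType) :
  polish R T -> @second_countable T.
Proof.
move=> [[D cD dD] [m mT _]]; pose M : pseudoMetricType R := Metric.Pack m.
have oE : @open M = @open T := mT.
have [|B cB [oB bB]] := @separable_second_countable R M.
  by exists D => // U U0; rewrite oE; exact: dD.
exists B => //; split=> [U|x U]; first by rewrite -oE; exact: oB.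
rewrite nbhsE => -[V [oV Vx] VU].
have [|W BW WV] := bB x V; last by exists W => //; exact: subset_trans VU.
by apply: (@open_nbhs_nbhs M); split=> //; rewrite oE.
Qed.

Theorem theorem9 (R : realType) (G : topologicalGroupType)
    (X : topologicalType) (f : G -> X) (S T : set G) :
  polish R G -> separable X -> metrizable R X ->
  baire_function f -> baire_property S -> shift_continuous S T f ->
  forall x, [set (a * b)%g | a in BD S & b in SC T] x ->
    {for x, continuous f}.
Proof.
move=> /polish_second_countable Gsc _ /metrizable_regular Xreg fB _ fST x STx.
exact: shift_continuous_at Gsc _ _ _ _ _ Xreg fB fST STx.
Qed.
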